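(* Let $k$ and $n$ be non-negative integers. Let $p_1,p_2,\ldots,p_{k+1}$ be primes such that $p_i\geq 5$ and $p_i\not\equiv 1 \pmod 6$ for each $1\leq i\leq k+1$. Then for any integer $j\not\equiv 0 \pmod{p_{k+1}}$, $$\bar{B}_{2,9}\left(6p_1^2p_2^2\cdots p_{k+1}^2 n + (6j+p_{k+1})p_1^2p_2^2\cdots p_k^2 p_{k+1}\right)\equiv 0 \pmod 8.$$
   Context: An overpartition of a positive integer $n$ is a partition of $n$ in which the first occurrence of each distinct part may be overlined. For coprime integers $\ell_1,\ell_2>1$, $\bar{B}_{\ell_1,\ell_2}(n)$ denotes the number of overpartitions of $n$ in which no part is divisible by $\ell_1$ or by $\ell_2$, with $\bar{B}_{\ell_1,\ell_2}(0)=1$. *)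

(* Defs.v *)
From mathcomp Require Import all_boot all_order all_algebra.

Set Implicit Arguments.
Unset Strict Implicit.
Unset Printing Implicit Defensive.

(* The entry [(m, b)] is a part of size [m], overlined iff [b]. Parts are listed
   in nonincreasing order; [pairwise] ranges over all pairs (earlier, later), so
   an overlined entry must be the first occurrence of its size. *)
Definition overpartition (n : nat) (s : seq (nat * bool)) : bool :=
  [&& all (fun x => 0 < x.1) s,
      pairwise (fun x y => (y.1 <= x.1) && (y.2 ==> (y.1 != x.1))) s
    & sumn (unzip1 s) == n].

Definition parts_ndvd (l : nat) (s : seq (nat * bool)) : bool :=
  all (fun x => ~~ (l %| x.1)) s.

Definition overpart_seq (n : nat) (s : n.-bseq ('I_n.+1 * bool)) :
    seq (nat * bool) :=
  [seq (nat_of_ord x.1, x.2) | x <- s].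

(* An overpartition of [n] has at most [n] parts, each at most [n], so ranging
   over [n.-bseq ('I_n.+1 * bool)] loses none: see [overpart_seq_surj]. *)
Definition Bbar_nat (l1 l2 n : nat) : nat :=
  #|[set s : n.-bseq ('I_n.+1 * bool) |
      [&& overpartition n (overpart_seq s),
          parts_ndvd l1 (overpart_seq s) & parts_ndvd l2 (overpart_seq s)]]|.

(* A negative integer has no overpartitions. *)
Definition Bbar (l1 l2 : nat) (n : int) : nat :=
  if n is Posz m then Bbar_nat l1 l2 m else 0.

Lemma overpart_seq_inj n : injective (@overpart_seq n).
Proof.
move=> s t /inj_map e; apply/val_inj/e => -[x b] [y c] /= [exy ->].
by congr pair; apply: val_inj.
Qed.

Lemma overpart_seq_surj n (s : seq (nat * bool)) :
  overpartition n s -> exists t : n.-bseq ('I_n.+1 * bool), overpart_seq t = s.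
Proof.
case/and3P=> s_gt0 _ /eqP sum_s.
have sz : size s <= n.
  rewrite -sum_s; elim: s s_gt0 {sum_s} => //= x s IHs /andP[x_gt0 /IHs].
  by rewrite -add1n => le_s; apply: leq_add.
have le_n x : x \in s -> x.1 < n.+1.
  rewrite ltnS -sum_s; elim: s {s_gt0 sum_s sz} => //= y s IHs.
  rewrite inE => /predU1P[-> | /IHs le_x]; first exact: leq_addr.
  by apply: leq_trans le_x _; apply: leq_addl.
pose t := [seq (inord x.1 : 'I_n.+1, x.2) | x <- s].
have szt : size t <= n by rewrite size_map.
exists (Bseq szt); rewrite /overpart_seq /= /t -map_comp -[RHS]map_id.
by apply/eq_in_map => -[x b] /le_n /= lt_x; rewrite inordK.
Qed.

Lemma Bbar0 l1 l2 : Bbar l1 l2 0%Z = 1.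
Proof.
rewrite /= /Bbar_nat -[RHS](cards1 ([bseq] : 0.-bseq ('I_1 * bool))).
congr #|pred_of_set _|; apply/setP => -[[|x s] le_s]; last by [].
by rewrite !inE.
Qed.

(* Main.v *)
(** An overpartition is a partition in which each distinct part size carries one
    of two labels, so it is counted with weight 2^(number of distinct sizes), and
    modulo 8 only the partitions with one or two sizes matter. Let A(i) be the
    number of divisors of i that are odd and prime to 9. Comparing ordered with
    unordered pairs of sizes, twice the number of partitions of N with two sizes
    is [sum_(i+j=N) A(i) A(j) - sigma(N) + d(N)] when gcd(N, 6) = 1, hence

      B(N) = 4 d(N) - 2 sigma(N) + 2 sum_(i+j=N) A(i) A(j)  (mod 8).

    The argument of B in the theorem is some N = 1 (mod 6) in which the prime
    q = p_(k+1), which is 5 mod 6, has odd valuation.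
    - The sum vanishes mod 4. It is symmetric, and A(i) A(j) is always even: A is
      even at the multiples of 3 (pair d with 3d), and at the odd numbers that
      are 2 mod 3 (pair d with its codivisor); if 3 divides neither i nor j then
      i = j = 2 (mod 3), and one of them is odd.
    - Pairing d with qd, for d of even q-valuation, shows that d(N) is even and
      that sigma(N) = (1 + q) S, where S sums such d. These d are in turn paired
      with N/(qd), which exchanges the residues 1 and 2 mod 3 because N/q = 2
      (mod 3), and all of them are odd: S is even, and 4 divides sigma(N). *)

Require Import Defs.
From mathcomp Require Import all_boot all_order all_algebra.
From mathcomp Require Import zify ring.

Import GRing.Theory.

Set Implicit Arguments.
Unset Strict Implicit.
Unset Printing Implicit Defensive.

(** * Convolution as multiplication of power series coefficients *)

Definition conv (f g : nat -> nat) (n : nat) : nat :=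
  \sum_(0 <= i < n.+1) f i * g (n - i).

Lemma convC f g n : conv f g n = conv g f n.
Proof.
rewrite /conv big_nat_rev; apply: eq_big_nat => i /andP[_ lt_in].
by rewrite add0n subSS mulnC subKn.
Qed.

Lemma eq_conv f f' g g' n : f =1 f' -> g =1 g' -> conv f g n = conv f' g' n.
Proof. by move=> ef eg; apply: eq_bigr => i _; rewrite ef eg. Qed.

Lemma convDr f g h n :
  conv f (fun i => g i + h i) n = conv f g n + conv f h n.
Proof. by rewrite -big_split; apply: eq_bigr => i _; rewrite mulnDr. Qed.

Lemma convDl f g h n :
  conv (fun i => f i + g i) h n = conv f h n + conv g h n.
Proof. by rewrite convC convDr !(convC h). Qed.

Lemma convZr c f g n : conv f (fun i => c * g i) n = c * conv f g n.
Proof. by rewrite big_distrr; apply: eq_bigr => i _; rewrite mulnCA. Qed.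

Lemma conv_delta0 f n : conv f (fun i => (i == 0) : nat) n = f n.
Proof.
rewrite /conv big_nat_recr //= subnn eqxx muln1 big_nat big1 // => i lt_in.
by case/andP: lt_in => _ lt_in; rewrite subn_eq0 leqNgt lt_in muln0.
Qed.

(** * Enumeration of the overpartitions with parts in [P], by largest part *)

Section OverpartitionCount.

Variable P : pred nat.

Definition pmult (d i : nat) : bool := [&& P d, 0 < i & d %| i].

(* The block formed by the parts of size [d] when they add up to [i]. *)
Definition run (d : nat) (b : bool) (i : nat) : seq (nat * bool) :=
  (d, b) :: nseq (i %/ d).-1 (d, false).

(** The recursion on [m] mirrors the generating function: an admissible size [m] contributes the
    factor 1 + 2 (x^m + x^(2m) + ...), the 2 being the choice of overlining the first copy. *)
Fixpoint opart_enum (m n : nat) : seq (seq (nat * bool)) :=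
  if m is m'.+1 then
    let block b := [seq run m b i ++ t | i <- [seq i <- iota 0 n.+1 | pmult m i],
                                         t <- opart_enum m' (n - i)] in
    opart_enum m' n ++ block true ++ block false
  else if n == 0 then [:: [::]] else [::].

Lemma opart_enumS m n :
  let block b := [seq run m.+1 b i ++ t |
      i <- [seq i <- iota 0 n.+1 | pmult m.+1 i], t <- opart_enum m (n - i)] in
  opart_enum m.+1 n = opart_enum m n ++ block true ++ block false.
Proof. by []. Qed.

Lemma size_opart_enumS m n :
  size (opart_enum m.+1 n) =
    size (opart_enum m n)
      + 2 * conv (fun i => pmult m.+1 i) (fun i => size (opart_enum m i)) n.
Proof.
have sz b : size [seq run m.+1 b i ++ t |
      i <- [seq i <- iota 0 n.+1 | pmult m.+1 i], t <- opart_enum m (n - i)]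
    = conv (fun i => pmult m.+1 i) (fun i => size (opart_enum m i)) n.
  rewrite size_allpairs_dep sumnE big_map big_filter /conv /index_iota subn0.
  by rewrite big_mkcond; apply: eq_bigr => i _; case: ifP; rewrite ?mul1n.
by rewrite opart_enumS !size_cat !sz addnn mul2n.
Qed.

Definition opart_le (m n : nat) (s : seq (nat * bool)) : bool :=
  overpartition n s && all (fun x => (x.1 <= m) && P x.1) s.

Lemma sumn_run d b i : pmult d i -> sumn (unzip1 (run d b i)) = i.
Proof.
case/and3P=> _ i_gt0 d_i; have d_gt0 := dvdn_gt0 i_gt0 d_i.
rewrite /run /= /unzip1 map_nseq sumn_nseq /= -mulnS prednK ?divn_gt0 //.
  by rewrite mulnC divnK.
exact: dvdn_leq.
Qed.

Lemma opart_le_run m b i n t : i <= n -> pmult m.+1 i ->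
  opart_le m (n - i) t -> opart_le m.+1 n (run m.+1 b i ++ t).
Proof.
move=> le_in dvd_i /andP[/and3P[t_gt0 t_pw /eqP t_sum] t_le].
have [Pm _ _] := and3P dvd_i.
have tlt x : x \in t -> x.1 < m.+1 by move=> /(allP t_le) /andP[].
apply/andP; split; last first.
  rewrite all_cat /= all_nseq /= leqnn Pm orbT /=.
  by apply: sub_all t_le => x /andP[/leqW-> ->].
apply/and3P; split.
- by rewrite all_cat t_gt0 /= all_nseq orbT.
- rewrite pairwise_cat t_pw /= all_nseq leqnn orbT /= andbT.
  apply/andP; split.
    apply/allrelP => x y; rewrite inE mem_nseq => x_in /tlt y_lt.
    have ->: x.1 = m.+1 by case/predU1P: x_in => [->|/andP[_ /eqP->]].
    by rewrite ltnW // neq_ltn y_lt implybT.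
  by elim: (i %/ m.+1).-1 => //= k ->; rewrite all_nseq leqnn orbT.
- by rewrite /unzip1 map_cat sumn_cat sumn_run // t_sum subnKC.
Qed.

(** Meant for the tail that follows an entry of size [m.+1]: that entry forbids overlining further
    copies, and monotonicity puts these copies first. *)
Lemma split_run m s :
  pairwise (fun x y : nat * bool => (y.1 <= x.1) && (y.2 ==> (y.1 != x.1))) s ->
  all (fun x => (x.1 <= m.+1) && (x.2 ==> (x.1 != m.+1))) s ->
  exists k t, s = nseq k (m.+1, false) ++ t /\ all (fun x => x.1 <= m) t.
Proof.
elim: s => [|[d b] s IHs] /=; first by exists 0, [::].
case/andP=> x_s s_pw /andP[/andP[le_d nb] s_le].
have [lt_d | ge_d] := ltnP d m.+1.
  exists 0, ((d, b) :: s); split=> //=; rewrite -ltnS lt_d.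
  by apply: sub_all x_s => y /andP[le_y _]; apply: leq_trans le_y _.
have ed : d = m.+1 by apply/eqP; rewrite eqn_leq le_d.
have [k [t [-> t_le]]] := IHs s_pw s_le.
move: nb; rewrite ed eqxx implybF => /negbTE->.
by exists k.+1, t.
Qed.

Lemma mem_opart_enum m n s : (s \in opart_enum m n) = opart_le m n s.
Proof.
elim: m n s => [|m IHm] n s.
  rewrite /= /opart_le /overpartition.
  case: s => [|x s] /=; first by case: n.
  by rewrite (leqNgt x.1 0); case: (0 < x.1); rewrite ?andbF; case: (n == 0).
apply/idP/idP.
  rewrite opart_enumS !mem_cat => /or3P[|/allpairsPdep|/allpairsPdep].
  - rewrite IHm => /andP[s_op s_le]; rewrite /opart_le s_op.
    by apply: sub_all s_le => x /andP[/leqW-> ->].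
  - case=> i [t [i_in t_in ->]]; move: i_in t_in.
    rewrite mem_filter mem_iota IHm => /andP[dvd_i le_i].
    exact: opart_le_run.
  - case=> i [t [i_in t_in ->]]; move: i_in t_in.
    rewrite mem_filter mem_iota IHm => /andP[dvd_i le_i].
    exact: opart_le_run.
move=> /[dup] s_op /andP[/and3P[s_gt0 s_pw /eqP s_sum] s_le].
have [s_lem | ] := boolP (all (fun x => x.1 <= m) s).
  rewrite opart_enumS mem_cat IHm /opart_le; apply/orP; left.
  rewrite all_predI s_lem.
  case/andP: s_op => -> /=; apply: sub_all => x /andP[] //.
case: s s_op s_gt0 s_pw s_sum s_le => // -[d b] s s_op s_gt0 s_pw s_sum s_le.
(* The head is the largest entry, so if it were at most [m], all entries would be. *)
move=> nle; have ed : d = m.+1.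
  move: s_pw s_le nle => /= /andP[d_s _] /andP[/andP[le_d _] _].
  apply: contraNeq => ne_d; have lt_d : d <= m by rewrite -ltnS ltn_neqAle ne_d.
  rewrite lt_d; apply: sub_all d_s => y /andP[le_y _]; exact: leq_trans lt_d.
rewrite {d nle}ed in s_op s_gt0 s_pw s_sum s_le *.
rewrite /= in s_gt0 s_pw s_sum s_le.
case/andP: s_pw => d_s s_pw; case/andP: s_le => /andP[_ Pm] s_le.
have [k [t [es t_le]]] := split_run s_pw d_s.
(* The head and the [k] plain copies that follow it make up the block. *)
set i := k.+1 * m.+1.
have sum_t : i + sumn (unzip1 t) = n.
  rewrite -s_sum es /= /unzip1 map_cat sumn_cat map_nseq sumn_nseq /=.
  by rewrite /i mulSn addnA (mulnC m.+1).
have le_i : i <= n by rewrite -sum_t leq_addr.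
have dvd_i : pmult m.+1 i by rewrite /pmult Pm /i dvdn_mull.
have t_in : t \in opart_enum m (n - i).
  rewrite IHm /opart_le /overpartition -sum_t addKn eqxx andbT.
  move: s_gt0 s_pw s_le; rewrite es !all_cat pairwise_cat.
  move=> /andP[_ ->] /and3P[_ _ ->] /andP[_ t_P] /=.
  rewrite all_predI t_le; apply: sub_all t_P => x /andP[] //.
have er : (m.+1, b) :: s = run m.+1 b i ++ t by rewrite es /run /i mulnK.
have i_in : i \in [seq i <- iota 0 n.+1 | pmult m.+1 i].
  by rewrite mem_filter dvd_i mem_iota.
rewrite er opart_enumS !mem_cat; apply/or3P.
by case: b {s_op er}; [apply: Or32 | apply: Or33];
   apply/allpairsPdep; exists i, t.
Qed.

Lemma opart_enum_uniq m n : uniq (opart_enum m n).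
Proof.
elim: m n => [|m IHm] n; first by rewrite /=; case: eqP.
have part_le k s : s \in opart_enum m k -> all (fun x => x.1 <= m) s.
  rewrite mem_opart_enum => /andP[_]; apply: sub_all => x /andP[] //.
have uniq_block b : uniq [seq run m.+1 b i ++ t |
    i <- [seq i <- iota 0 n.+1 | pmult m.+1 i], t <- opart_enum m (n - i)].
  apply: allpairs_uniq_dep => [|i _ //|]; first by rewrite filter_uniq ?iota_uniq.
  move=> u v /allpairsPdep[i [t [i_in /part_le t_le ->]]].
  move=> /allpairsPdep[i' [t' [i'_in /part_le t'_le ->]]] /= [e].
  (* The tails have no entry of size [m.+1], so counting such entries recovers the multiplicity, and
     with it [i]. *)
  have cnt w : all (fun x : nat * bool => x.1 <= m) w ->
      count (fun x => x.1 == m.+1) w = 0.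
    move=> w_le; apply/eqP; rewrite -leqn0 leqNgt -has_count -all_predC.
    by apply: sub_all w_le => x /=; rewrite neq_ltn ltnS => ->.
  have ek : (i %/ m.+1).-1 = (i' %/ m.+1).-1.
    move/(congr1 (count (fun x => x.1 == m.+1))): e.
    by rewrite !count_cat (cnt t) // (cnt t') // !count_nseq /= eqxx !mul1n !addn0.
  move: e; rewrite ek => /eqP; rewrite eqseq_cat // => /andP[_ /eqP <-].
  suff -> : i = i' by [].
  move: i_in i'_in; rewrite !mem_filter => /andP[di _] /andP[di' _].
  by rewrite -(sumn_run true di) -(sumn_run true di') /run ek.
rewrite opart_enumS !cat_uniq IHm !uniq_block /= andbT.
(* A head of size [m.+1] separates the blocks from the rest, and its flag separates the two
   blocks. *)
apply/andP; split; apply/hasPn => s.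
  rewrite mem_cat; apply: contraL => /part_le s_le.
  by apply/norP; split; apply/allpairsPdep => -[i [t [_ _ e]]];
     move: s_le; rewrite e /= ltnn.
by case/allpairsPdep=> i [t [_ _ ->]]; apply/allpairsPdep => -[j [u [_ _]]].
Qed.

(** * Reduction modulo 8 to partitions with one or two sizes *)

Definition pmults (m i : nat) : nat := \sum_(1 <= d < m.+1) pmult d i.

Lemma pmultsS m i : pmults m.+1 i = pmults m i + pmult m.+1 i.
Proof. by rewrite /pmults big_nat_recr. Qed.

(* The number of pairs of blocks of distinct sizes that add up to [n]. *)
Fixpoint two_sizes (m n : nat) : nat :=
  if m is m'.+1 then
    two_sizes m' n + conv (fun i => pmult m i) (pmults m') n
  else 0.

(** With X_d the series of [pmult d], this expands the product of the factors 1 + 2 X_d: a product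
    of three or more terms 2 X_d is divisible by 8. *)
Lemma size_opart_enum_mod8 m n :
  size (opart_enum m n)
    = (n == 0) + 2 * pmults m n + 4 * two_sizes m n %[mod 8].
Proof.
suff [R eR] : exists R, forall n, size (opart_enum m n)
    = (n == 0) + 2 * pmults m n + 4 * two_sizes m n + 8 * R n.
  by rewrite eR addnC (mulnC 8) modnMDl.
elim: m {n} => [|m [R IHm]].
  by exists (fun=> 0) => n; rewrite /pmults big_geq //=; case: eqP.
(* Twice the convolution of [pmult m.+1] with [4 * two_sizes + 8 * R] is 8 times the added term. *)
exists (fun n => R n + conv (fun i => pmult m.+1 i)
                         (fun i => two_sizes m i + 2 * R i) n) => n.
rewrite size_opart_enumS (eq_conv _ (fun=> erefl) IHm).
rewrite (convDr _ _ (fun i => 8 * R i)) (convDr _ _ (fun i => 4 * two_sizes m i)).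
rewrite (convDr _ _ (fun i => 2 * pmults m i)) (convDr _ (two_sizes m)) !convZr.
rewrite conv_delta0 IHm pmultsS /=; lia.
Qed.

(** A multiple [n] of an admissible [d] splits into two positive multiples of [d] in [n %/ d - 1]
    ordered ways; any other [n] in none. *)
Lemma conv_pmult d n : 0 < n ->
  conv (fun i => pmult d i) (fun i => pmult d i) n + pmult d n
    = pmult d n * (n %/ d).
Proof.
move=> n_gt0; rewrite /pmult n_gt0 /=.
have [/andP[Pd d_n] | ] := boolP (P d && (d %| n)); last first.
  move=> nd; rewrite addn0 mul0n /conv big1 // => i _.
  case: and3P => // -[Pd i_gt0 d_i]; rewrite Pd /= in nd *.
  rewrite mul1n; case: andP => // -[ni_gt0 d_ni].
  by case/negP: nd;
    rewrite -(subnKC (n := n) (m := i)) ?dvdn_add // ltnW // -subn_gt0.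
rewrite mul1n divn_count_dvd [RHS]big_nat_recr //= d_n; congr (_ + _).
rewrite /conv big_nat_recr //= subnn andbF muln0 addn0.
case: n n_gt0 d_n => // n _ d_n; rewrite big_nat_recl //= andbF mul0n add0n.
rewrite big_add1 /=; apply: eq_big_nat => i /andP[_ lt_in].
rewrite Pd /= subn_gt0 ltnS lt_in /=.
have [d_i | //] := boolP (d %| i.+1).
by rewrite dvdn_sub.
Qed.

(** The square of the sum of the X_d is twice the sum of the products of distinct X_d plus the sum
    of the squares, and [conv_pmult] evaluates the squares. *)
Lemma two_sizesE m n : 0 < n ->
  2 * two_sizes m n + \sum_(1 <= d < m.+1) pmult d n * (n %/ d)
    = conv (pmults m) (pmults m) n + pmults m n.
Proof.
move=> n_gt0; elim: m => [|m IHm].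
  rewrite /pmults !big_geq // /conv big1 // => i _.
  by rewrite big_geq.
rewrite big_nat_recr //= -conv_pmult // (eq_conv _ (pmultsS m) (pmultsS m)).
rewrite convDl !convDr (convC (pmults m) (fun i => pmult m.+1 i)) pmultsS.
lia.
Qed.

Lemma sum_pmult m n (F : nat -> nat) : 0 < n <= m ->
  \sum_(1 <= d < m.+1) pmult d n * F d = \sum_(d <- divisors n | P d) F d.
Proof.
case/andP=> n_gt0 le_nm.
rewrite [RHS](perm_big [seq d <- index_iota 1 m.+1 | d %| n]) /=; last first.
  apply: uniq_perm; rewrite ?divisors_uniq ?filter_uniq ?iota_uniq // => d.
  rewrite -dvdn_divisors // mem_filter mem_index_iota ltnS.
  have [d_n | //] := boolP (d %| n); rewrite (dvdn_gt0 n_gt0 d_n) /=.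
  by apply/esym; apply: leq_trans le_nm; apply: dvdn_leq.
rewrite big_filter_cond [RHS]big_mkcond; apply: eq_bigr => d _.
by rewrite /pmult n_gt0 /= andbC; case: ifP; rewrite ?mul1n.
Qed.

Lemma pmultsE m n : 0 < n <= m -> pmults m n = count P (divisors n).
Proof.
move=> nm; rewrite -sum1_count -(sum_pmult _ nm).
by apply: eq_bigr => d _; rewrite muln1.
Qed.

Lemma pmults0 m : pmults m 0 = 0.
Proof. by rewrite /pmults big1 // => d _; rewrite /pmult andbF. Qed.

End OverpartitionCount.

(** * Pairing arguments for convolutions and for divisor counts *)

Lemma conv_self_mod4 f n : odd n ->
  (forall i, i <= n -> 2 %| f i * f (n - i)) -> 4 %| conv f f n.
Proof.
move=> n_odd ev; set h := n.+1./2.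
have en : n.+1 = h + h by rewrite addnn even_halfK //= n_odd.
(* As [n] is odd, [i] and [n - i] never coincide, so the reflection exchanges the two halves of the
   range. *)
have half : \sum_(h <= i < n.+1) f i * f (n - i)
    = \sum_(0 <= i < h) f i * f (n - i).
  rewrite -{1}[h]add0n big_addn {1}en addnK big_nat_rev /= add0n.
  apply: eq_big_nat => i /andP[_ lt_ih]; rewrite mulnC.
  by congr (f _ * f _); lia.
rewrite /conv (big_cat_nat _ (n := h)) //=; last by rewrite en leq_addr.
rewrite half addnn -mul2n -[4]/(2 * 2) dvdn_pmul2l //.
rewrite big_nat; apply: dvdn_sum => i /andP[_ lt_ih]; apply: ev; lia.
Qed.

(** Every pairing of divisors below is an instance, with [s] the list of divisors. *)
Lemma sum_reindex_seq (s : seq nat) (a b : pred nat) (f g F : nat -> nat) :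
    uniq s ->
    (forall x, x \in s -> a x -> [/\ f x \in s, b (f x) & g (f x) = x]) ->
    (forall y, y \in s -> b y -> [/\ g y \in s, a (g y) & f (g y) = y]) ->
  \sum_(y <- s | b y) F y = \sum_(x <- s | a x) F (f x).
Proof.
move=> s_uniq fP gP; rewrite -big_filter -[RHS]big_filter -(big_map f predT F).
apply: perm_big; apply: uniq_perm; rewrite ?filter_uniq //.
  rewrite map_inj_in_uniq ?filter_uniq // => x y; rewrite !mem_filter.
  case/andP=> ax x_s /andP[ay y_s] e.
  by have [_ _ <-] := fP x x_s ax; have [_ _ <-] := fP y y_s ay; rewrite e.
move=> y; rewrite mem_filter; apply/andP/mapP.
  case=> b_y y_s; have [gs ga e] := gP y y_s b_y.
  by exists (g y); rewrite // mem_filter ga.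
case=> x; rewrite mem_filter => /andP[ax x_s] ->.
by have [] := fP x x_s ax.
Qed.

Definition allowed (d : nat) : bool := ~~ (2 %| d) && ~~ (9 %| d).

(** Since 9 divides no allowed number, [d -> 3 * d] is a bijection from the allowed divisors prime
    to 3 onto the allowed divisors that 3 divides. *)
Lemma even_count_allowed3 n : 0 < n -> 3 %| n ->
  2 %| count allowed (divisors n).
Proof.
move=> n_gt0 n3.
rewrite -sum1_count (bigID (fun d => 3 %| d)) /=.
rewrite (@sum_reindex_seq _ (fun d => allowed d && ~~ (3 %| d)) _
  (fun d => 3 * d) (fun d => d %/ 3)) ?divisors_uniq ?addnn ?dvdn2 ?odd_double //.
- move=> d; rewrite -!dvdn_divisors // => d_n /andP[al nd3].
  rewrite Gauss_dvd ?prime_coprime // n3 d_n dvdn_mulr // mulKn //.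
  by split=> //; move: al nd3; rewrite /allowed; lia.
- move=> d; rewrite -!dvdn_divisors // => d_n /andP[al d3].
  rewrite (dvdn_trans _ d_n) ?dvdn_div // mulnC divnK //; split=> //.
  by move: al d3; rewrite /allowed; lia.
Qed.

Lemma mod3_mul2 a b : (a * b) %% 3 = 2 ->
  a %% 3 = 1 /\ b %% 3 = 2 \/ a %% 3 = 2 /\ b %% 3 = 1.
Proof.
rewrite -modnMm; have := ltn_pmod a (isT : 0 < 3); have := ltn_pmod b (isT : 0 < 3).
by case: (a %% 3) => [|[|[|?]]]; case: (b %% 3) => [|[|[|?]]] //; auto.
Qed.

Lemma divn_codivisor n d : 0 < n -> d %| n -> n %/ (n %/ d) = d.
Proof.
move=> n_gt0 d_n; rewrite -{1}(divnK d_n) mulKn // divn_gt0.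
  exact: dvdn_leq.
exact: dvdn_gt0 d_n.
Qed.

Lemma dvdn_allowed n d : odd n -> n %% 3 != 0 -> d %| n -> allowed d.
Proof.
move=> n_odd n3 d_n; rewrite /allowed dvdn2 (dvdn_odd d_n) //=.
by apply: contraNN n3 => d9; apply: dvdn_trans d_n; apply: dvdn_trans d9.
Qed.

Lemma even_count_allowed2 n : odd n -> n %% 3 = 2 ->
  2 %| count allowed (divisors n).
Proof.
move=> n_odd n3; have n_gt0 := odd_gt0 n_odd.
have al d : d %| n -> allowed d by apply: dvdn_allowed; rewrite // n3.
have dmod d : d %| n -> (n %/ d * d) %% 3 = 2 by move=> /divnK ->.
(* Codivisors have residues 1 and 2 modulo 3 in some order, so the pairing has no fixed point. *)
have swap d : d %| n -> (n %/ d %% 3 == 1) = (d %% 3 != 1).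
  by move=> /dmod/mod3_mul2[][-> ->].
rewrite -sum1_count (bigID (fun d => d %% 3 == 1)) /=.
rewrite (@sum_reindex_seq _ (fun d => allowed d && (d %% 3 != 1)) _
  (fun d => n %/ d) (fun d => n %/ d)) ?divisors_uniq ?addnn ?dvdn2 ?odd_double //.
- move=> d; rewrite -!dvdn_divisors // => d_n /andP[_ nd].
  by rewrite dvdn_div // al ?dvdn_div // swap // nd divn_codivisor.
- move=> d; rewrite -!dvdn_divisors // => d_n /andP[_ dd].
  have qd := dvdn_div d_n.
  by rewrite qd al // -swap // divn_codivisor // dd.
Qed.

(** * Divisors of a number of odd [q]-valuation *)

Section OddValuation.

Variables q n : nat.
Hypotheses (q_prime : prime q) (q_odd : odd q) (q3 : q %% 3 = 2).
Hypotheses (n_odd : odd n) (n3 : n %% 3 = 1) (logn_odd : odd (logn q n)).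

Let n_gt0 : 0 < n. Proof. exact: odd_gt0. Qed.

(** The cofactor [n %/ d] has odd, hence positive, [q]-valuation. *)
Lemma dvdn_even_logn d : d %| n -> ~~ odd (logn q d) -> q * d %| n.
Proof.
move=> d_n ev; have d_gt0 := dvdn_gt0 n_gt0 d_n.
rewrite -(divnK d_n) dvdn_pmul2r //.
have qn_gt0 : 0 < n %/ d by rewrite divn_gt0 // dvdn_leq.
have : odd (logn q (n %/ d)).
  move: logn_odd; rewrite -{1}(divnK d_n) lognM // oddD (negbTE ev) addbF //.
by move/odd_gt0; rewrite logn_gt0 mem_primes => /and3P[].
Qed.

Lemma sum_divisors_logn (F : nat -> nat) :
  \sum_(d <- divisors n) F d
    = \sum_(d <- divisors n | ~~ odd (logn q d)) (F d + F (q * d)).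
Proof.
rewrite (bigID (fun d => ~~ odd (logn q d))) /= big_split; congr (_ + _).
have q_gt0 := prime_gt0 q_prime.
apply: (sum_reindex_seq (g := fun d => d %/ q)); first exact: divisors_uniq.
  move=> d; rewrite -!dvdn_divisors // => d_n ev.
  rewrite dvdn_even_logn // mulKn // lognM // ?(dvdn_gt0 n_gt0 d_n) //.
  by rewrite logn_prime // eqxx oddD (negbTE ev).
move=> d; rewrite -!dvdn_divisors // negbK => d_n od.
have := odd_gt0 od; rewrite logn_gt0 mem_primes => /and3P[_ d_gt0 q_d].
rewrite (dvdn_trans _ d_n) ?dvdn_div // mulnC divnK //; split=> //.
have dq_gt0 : 0 < d %/ q by rewrite divn_gt0 // dvdn_leq.
by move: od; rewrite -{1}(divnK q_d) (lognM _ dq_gt0 q_gt0)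
  (logn_prime _ q_prime) eqxx addn1.
Qed.

Lemma even_size_divisors : 2 %| size (divisors n).
Proof.
by rewrite -sum1_size sum_divisors_logn; apply: dvdn_sum => d _.
Qed.

Lemma sum_divisors_mod4 : 4 %| \sum_(d <- divisors n) d.
Proof.
rewrite sum_divisors_logn -[4]/(2 * 2).
under eq_bigr => d _ do rewrite -mulSn.
(* One factor 2 comes from [q.+1]; the other must come from the sum over the divisors of even
   valuation. *)
rewrite -big_distrr; apply: dvdn_mul; first by rewrite dvdn2 /= q_odd.
have q_gt0 := prime_gt0 q_prime.
have q_n : q %| n.
  by have := odd_gt0 logn_odd; rewrite logn_gt0 mem_primes => /and3P[].
(* These divisors are the divisors of [N] of even [q]-valuation. That valuation is even at [N] too,
   so [d -> N %/ d] permutes them. *)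
set N := n %/ q; have en : n = q * N by rewrite mulnC divnK.
have N_gt0 : 0 < N by move: n_gt0; rewrite en muln_gt0 => /andP[].
have N3 : N %% 3 = 2.
  move: n3; rewrite en -modnMm q3; have := ltn_pmod N (isT : 0 < 3).
  by case: (N %% 3) => [|[|[|?]]].
have N_ev : ~~ odd (logn q N).
  by move: logn_odd; rewrite en lognM // logn_prime // eqxx.
have dN d : d %| n -> ~~ odd (logn q d) -> d %| N.
  by move=> d_n /(dvdn_even_logn d_n); rewrite en dvdn_pmul2l.
have Nn d : d %| N -> d %| n by move=> d_N; rewrite en dvdn_mull.
have swap d : d %| N -> (N %/ d %% 3 == 1) = (d %% 3 != 1).
  by move=> d_N; have := N3; rewrite -{1}(divnK d_N) => /mod3_mul2[][-> ->].
have lg d : d %| N -> ~~ odd (logn q d) -> ~~ odd (logn q (N %/ d)).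
  move=> d_N ev; move: N_ev; have d_gt0 := dvdn_gt0 N_gt0 d_N.
  have Nd_gt0 : 0 < N %/ d by rewrite divn_gt0 // dvdn_leq.
  by rewrite -{1}(divnK d_N) (lognM _ Nd_gt0 d_gt0) oddD (negbTE ev) addbF.
rewrite (bigID (fun d => d %% 3 == 1)) /=.
rewrite (@sum_reindex_seq _ (fun d => ~~ odd (logn q d) && (d %% 3 != 1)) _
  (fun d => N %/ d) (fun d => N %/ d)) ?divisors_uniq //.
- rewrite -big_split big_seq_cond; apply: dvdn_sum => d.
  rewrite -dvdn_divisors // => /and3P[d_n ev _].
  have d_N := dN d d_n ev.
  rewrite dvdn2 oddD (dvdn_odd d_n) // (dvdn_odd (Nn _ (dvdn_div d_N))) //.
- move=> d; rewrite -!dvdn_divisors // => d_n /andP[ev nd].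
  have d_N := dN d d_n ev.
  by rewrite Nn ?dvdn_div // lg // swap // nd divn_codivisor.
- move=> d; rewrite -!dvdn_divisors // => d_n /andP[ev dd].
  have d_N := dN d d_n ev; have qd := dvdn_div d_N.
  by rewrite Nn // lg // -swap // divn_codivisor // dd.
Qed.

End OddValuation.

(** * The congruence for an argument of odd [q]-valuation *)

Lemma Bbar_natE l1 l2 n :
  Bbar_nat l1 l2 n =
    size (opart_enum (fun d => ~~ (l1 %| d) && ~~ (l2 %| d)) n n).
Proof.
rewrite /Bbar_nat cardE -(size_map (@overpart_seq n)); apply: perm_size.
apply: uniq_perm; rewrite ?opart_enum_uniq ?map_inj_uniq ?enum_uniq //.
  exact: overpart_seq_inj.
move=> s; rewrite mem_opart_enum; apply/mapP/idP.
  case=> t; rewrite mem_enum inE => /and3P[op p1 p2] ->.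
  rewrite /opart_le op; apply/allP => x x_t.
  rewrite (allP p1 x x_t) (allP p2 x x_t) !andbT /=.
  by case/mapP: x_t => y _ ->; rewrite -ltnS ltn_ord.
case/andP=> op al; have [t et] := overpart_seq_surj op.
exists t => //; rewrite mem_enum inE et op /=.
by apply/andP; split; apply: sub_all al => x /and3P[].
Qed.

Lemma Bbar_2_9_mod8 q n :
    prime q -> odd q -> q %% 3 = 2 -> odd n -> n %% 3 = 1 -> odd (logn q n) ->
  8 %| Bbar_nat 2 9 n.
Proof.
move=> q_pr q_odd q3 n_odd n3 lg; have n_gt0 := odd_gt0 n_odd.
rewrite Bbar_natE -/allowed /dvdn size_opart_enum_mod8 (gtn_eqF n_gt0) add0n.
have al d : d \in divisors n -> allowed d.
  by rewrite -dvdn_divisors //; apply: dvdn_allowed; rewrite // n3.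
have An : pmults allowed n n = size (divisors n).
  by rewrite pmultsE ?n_gt0 ?leqnn //; apply/eqP; rewrite -all_count; apply/allP.
have := two_sizesE allowed n n_gt0; rewrite sum_pmult ?n_gt0 ?leqnn // An.
(* All divisors of [n] are allowed, and passing to codivisors permutes them. *)
have -> : \sum_(d <- divisors n | allowed d) n %/ d = \sum_(d <- divisors n) d.
  rewrite (@sum_reindex_seq _ allowed predT (fun d => n %/ d) (fun d => n %/ d)) //.
  - exact: divisors_uniq.
  - move=> d; rewrite -!dvdn_divisors // => d_n _.
    by rewrite dvdn_div // divn_codivisor.
  - move=> d d_n _; move: (d_n); rewrite -!dvdn_divisors // => d_n'.
    by rewrite dvdn_div // divn_codivisor // al // -dvdn_divisors // dvdn_div.
have : 4 %| conv (pmults allowed n) (pmults allowed n) n.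
  apply: conv_self_mod4 => // i le_in.
  case: i le_in => [|i] le_in; first by rewrite pmults0.
  have [->|] := posnP (n - i.+1); first by rewrite pmults0 muln0.
  move=> ni_gt0; rewrite !pmultsE ?ni_gt0 ?leq_subr //.
  have [i3|i3] := boolP (3 %| i.+1).
    by rewrite dvdn_mulr // even_count_allowed3.
  have [j3|j3] := boolP (3 %| n - i.+1).
    by rewrite dvdn_mull // even_count_allowed3.
  (* Two nonzero residues modulo 3 with sum 1 are both 2. *)
  have [i_mod3 j_mod3] : i.+1 %% 3 = 2 /\ (n - i.+1) %% 3 = 2 by lia.
  have [i_odd|i_even] := boolP (odd i.+1).
    by rewrite dvdn_mulr // even_count_allowed2.
  by rewrite dvdn_mull // even_count_allowed2 // oddB // n_odd (negbTE i_even).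
have := sum_divisors_mod4 q_pr q_odd q3 n_odd n3 lg.
have := even_size_divisors q_pr n_odd lg.
(* Eliminating [two_sizes] leaves 4 d(n) - 2 sigma(n) + 2 C, with C the convolution, and 8 divides
   each term. *)
lia.
Qed.

(** * Arithmetic of the argument in the theorem *)

Lemma prime_ge5_mod6 q : prime q -> 5 <= q -> odd q && (q %% 3 != 0).
Proof.
move=> q_pr q_ge5; rewrite -[odd q]negbK -dvdn2 -/(3 %| q).
rewrite !dvdn_prime2 //; lia.
Qed.

Theorem theorem3p2 (k n : nat) (p : nat -> nat)
  (p_prime : forall i : nat, 1 <= i <= k.+1 -> prime (p i))
  (p_ge5 : forall i : nat, 1 <= i <= k.+1 -> 5 <= p i)
  (p_mod6 : forall i : nat, 1 <= i <= k.+1 -> p i <> 1 %[mod 6])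
  (j : int) (hj : (j <> 0 %[mod Posz (p k.+1)])%Z) :
  Bbar 2 9
    (6%:Z * (\prod_(1 <= i < k.+2) (p i)%:Z ^+ 2) * n%:Z
     + (6%:Z * j + (p k.+1)%:Z)
       * (\prod_(1 <= i < k.+1) (p i)%:Z ^+ 2) * (p k.+1)%:Z)%R
  = 0 %[mod 8].
Proof.
have k_in : 1 <= k.+1 <= k.+1 by rewrite leqnn.
set q := p k.+1 in hj *; set M := (X in Bbar _ _ X).
have q_pr : prime q := p_prime _ k_in; have q_ge5 : 5 <= q := p_ge5 _ k_in.
have /andP[q_odd q_n3] := prime_ge5_mod6 q_pr q_ge5.
have q3 : q %% 3 = 2 by move: (p_mod6 _ k_in); rewrite -/q; lia.
pose P := \prod_(1 <= i < k.+1) p i.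
have eP : (\prod_(1 <= i < k.+1) (p i)%:Z ^+ 2 = P%:Z ^+ 2)%R.
  by rewrite prodrXl /P (big_morph Posz PoszM erefl).
have /andP[P_odd P3] : odd P && (P %% 3 != 0).
  rewrite /P big_nat; apply: (big_ind (fun x => odd x && (x %% 3 != 0))) => //.
    move=> x y /andP[x_odd x3] /andP[y_odd y3]; rewrite oddM x_odd y_odd /=.
    by rewrite -/(3 %| x * y) Euclid_dvdM // negb_or x3.
  move=> i /andP[i_ge1 i_lt]; have i_in : 1 <= i <= k.+1 by rewrite i_ge1 ltnW.
  by apply: prime_ge5_mod6; [apply: p_prime | apply: p_ge5].
(* The argument factors as [q * P ^ 2 * t]; since 6 divides [t - q], [t] inherits the residues of
   [q] modulo 2 and 3. *)
pose t : int := (6%:Z * (q%:Z * n%:Z + j) + q%:Z)%R.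
have eM : M = ((q * P ^ 2)%N%:Z * t)%R.
  rewrite /M big_nat_recr //= eP -/q /t PoszM -mulnn PoszM; ring.
have q_gt0 := prime_gt0 q_pr; have P_gt0 := odd_gt0 P_odd.
have qP_gt0 : 0 < q * P ^ 2 by rewrite muln_gt0 q_gt0 expn_gt0 P_gt0.
(* For a negative argument [Bbar] is 0 by definition. *)
case EM : M => [m|//]; rewrite EM in eM.
have [t' et] : exists t', t = Posz t'.
  case: (t) eM => [t'|t'] eM; first by exists t'.
  by move: eM; rewrite -(prednK qP_gt0).
move: eM; rewrite et -PoszM => -[em].
(* Modulo [q], [t] is [6 * j], and [q] is prime to 6. *)
have q_t : ~~ (q %| t').
  apply/negP => q_t; apply: hj; rewrite mod0z; apply/eqP.
  have : (Posz q %| (6%:Z * j)%R)%Z.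
    have -> : (6%:Z * j = t'%:Z - q%:Z * (6%:Z * n%:Z + 1))%R.
      by rewrite -et /t; ring.
    by rewrite rpredB ?dvdz_mulr // dvdzE.
  rewrite Gauss_dvdzr; first by move/dvdz_mod0P ->.
  by rewrite coprimezE /= prime_coprime // (@Euclid_dvdM 2 3) // !gtnNdvd //;
    apply: leq_trans q_ge5.
have t_gt0 : 0 < t' by case: (t') q_t => //; rewrite dvdn0.
have t_odd : odd t' by move: et; rewrite /t; lia.
have t3 : t' %% 3 = 2 by move: et; rewrite /t; lia.
have m3 : m %% 3 = 1.
  rewrite em -modnMm -(modnMm q) -modnXm t3 q3.
  have := ltn_pmod P (isT : 0 < 3).
  by case: (P %% 3) P3 => [|[|[|?]]].
have m_odd : odd m by rewrite em !oddM q_odd P_odd t_odd.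
(* The valuation is 1 plus an even contribution of [P ^ 2], even when [q] recurs among the other
   primes. *)
have m_log : odd (logn q m).
  rewrite em lognM // lognM ?expn_gt0 ?P_gt0 // lognX logn_prime // eqxx.
  by rewrite (@logn_coprime q t') ?prime_coprime // addn0 oddD mul2n odd_double.
by apply/eqP; have := Bbar_2_9_mod8 q_pr q_odd q3 m_odd m3 m_log.
Qed.
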